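(* Let $G$ be one of the following groups: $\mathbb{Z}$; $\bigoplus_0^\infty\mathbb{Z}(q)$ with $q\geq 2$ an integer; $\mathbb{Z}(q^\infty)$ with $q$ prime; or $\bigoplus_0^\infty\mathbb{Z}(q_n)$ with $(q_n)_{n\ge0}$ a strictly increasing sequence of odd positive integers. Let $G'$ and its enumeration $\{\chi_n\}_{n\ge1}$ be as in the context. Let $m\geq 2$ be an integer. Given any $\varepsilon>0$, there exist $K_m=K_m(G,\varepsilon)$ and a set $E\subseteq G'$ such that $$r_N^{(m)}(E)<K_m$$ for all $N$ ($N\in\mathbb{Z}$ if $G=\mathbb{Z}$, and $N\in\mathbb{N}\cup\{0\}$ otherwise), and there is a constant $c=c(G,m,\varepsilon)>0$ such that $$\mathrm{card}\left(\{\chi_1,\dots,\chi_n\}\cap E\right)\geq c\,n^{\frac1m-\varepsilon}$$ for all $n\ge1$ when $G=\mathbb{Z}$, $\bigoplus_0^\infty\mathbb{Z}(q)$ or $\mathbb{Z}(q^\infty)$, and for infinitely many $n$ when $G=\bigoplus_0^\infty\mathbb{Z}(q_n)$.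
   Context: $\mathbb{N}=\{1,2,\dots\}$; $\mathbb{Z}(k)$ is the cyclic group of order $k$; $\bigoplus_0^\infty$ denotes the countable direct sum indexed by $0,1,2,\dots$; $\mathbb{Z}(q^\infty)$ is the group of all $q^n$-th roots of unity, written additively as arguments $j/q^M$ mod $1$. $G'=\mathbb{N}$ if $G=\mathbb{Z}$ and $G'=G\setminus\{0\}$ otherwise. The elements of $G'$ are enumerated as $\{\chi_n\}_{n\geq1}$, and $\chi_0=0$: - $G=\mathbb{Z}$: $\chi_n=n$ (for all $n\in\mathbb{Z}$). - $G=\bigoplus_0^\infty\mathbb{Z}(q)$: with representatives $0\leq\psi_i<q$, the element $\psi=(\psi_i)_{i\ge0}\neq0$ with largest nonzero index $d$ is $\chi_n$ for $n=\psi_0+\psi_1q+\cdots+\psi_dq^d$. - $G=\mathbb{Z}(q^\infty)$: a nonzero $\psi$ is uniquely $j/q^M$ with $1\leq j\leq q^M-1$, $q\nmid j$; its degree is $M-1$. The $q^{d+1}-q^d$ elements of degree $d\geq0$ are assigned to the integers $q^d,\dots,q^{d+1}-1$ in the natural way (increasing order of $j$). - $G=\bigoplus_0^\infty\mathbb{Z}(q_n)$: use representatives in $\{-(q_i-1)/2,\dots,(q_i-1)/2\}$ for the $i$-th coordinate; the degree of $\psi\ne0$ is its largest nonzero index. For each $d\geq0$ and $r\in\{1,\dots,(q_d-1)/2\}$, the $2q_0\cdots q_{d-1}$ elements of degree $d$ with $d$-th coordinate $\pm r$ are identified, by a fixed bijection, with the integers in $[(2r-1)q_0\cdots q_{d-1},(2r+1)q_0\cdots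 q_{d-1})$, where $q_0\cdots q_{d-1}=1$ if $d=0$. For $E\subseteq G'$, $r_N^{(m)}(E)=\sum_{t=0}^m r_{N,t}^{(m)}(E)$, where $r_{N,t}^{(m)}(E)$ is the number of tuples $(a_1,\dots,a_m)\in\mathbb{N}^m$ with all $\chi_{a_i}\in E$, $\sum_{i=1}^t\chi_{a_i}-\sum_{i=t+1}^m\chi_{a_i}=\chi_N$, $a_1<\cdots<a_t$, $a_{t+1}<\cdots<a_m$, and $a_i\neq a_j$ for $i\neq j$ (for $t=0$ and $t=m$ one considers $-\sum_{i=1}^m\chi_{a_i}=\chi_N$ and $\sum_{i=1}^m\chi_{a_i}=\chi_N$ respectively, with $a_1<\cdots<a_m$). *)

(* Defs.v *)
From HB Require Import structures.
From mathcomp Require Import all_boot all_order all_algebra.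
From mathcomp Require Import all_classical all_reals all_analysis.

Set Implicit Arguments.
Unset Strict Implicit.
Unset Printing Implicit Defensive.

Import Order.TTheory GRing.Theory Num.Theory.

Local Open Scope classical_set_scope.
Local Open Scope ring_scope.

(* 'Z_k is not used here: it is Z/2 when k = 1, and k = 1 is allowed below.
   For k = 0 (never used) Zcyc k is the trivial group. *)
Definition Zcyc (k : nat) : zmodType := 'I_k.-1.+1.

Definition rep (k : nat) (x : Zcyc k) : nat := nat_of_ord (x : 'I_k.-1.+1).

Section DirectSum.
Variable V : nat -> zmodType.

Record direct_sum : Type := DirectSum {
  coord :> forall i : nat, V i ;
  coord_fin : exists n : nat, forall i : nat, (n <= i)%N -> coord i = 0 }.

HB.instance Definition _ := gen_eqMixin direct_sum.
HB.instance Definition _ := gen_choiceMixin direct_sum.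

Lemma direct_sum_ext (x y : direct_sum) : (forall i, x i = y i) -> x = y.
Proof.
case: x y => [f fP] [g gP] /= fg.
have {fg} e : f = g by apply: functional_extensionality_dep.
by subst g; congr DirectSum; apply: Prop_irrelevance.
Qed.

Definition dsum_zero : direct_sum.
Proof. by exists (fun=> 0); exists 0%N. Defined.

Definition dsum_opp (x : direct_sum) : direct_sum.
Proof.
exists (fun i => - x i); case: (coord_fin x) => n xn; exists n => i /xn ->.
by rewrite oppr0.
Defined.

Definition dsum_add (x y : direct_sum) : direct_sum.
Proof.
exists (fun i => x i + y i).
case: (coord_fin x) (coord_fin y) => n xn [p yp]; exists (maxn n p) => i.
by rewrite geq_max => /andP[/xn -> /yp ->]; rewrite addr0.
Defined.

Lemma dsum_addA : associative dsum_add.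
Proof. by move=> x y z; apply: direct_sum_ext => i /=; rewrite addrA. Qed.

Lemma dsum_addC : commutative dsum_add.
Proof. by move=> x y; apply: direct_sum_ext => i /=; rewrite addrC. Qed.

Lemma dsum_add0 : left_id dsum_zero dsum_add.
Proof. by move=> x; apply: direct_sum_ext => i /=; rewrite add0r. Qed.

Lemma dsum_addN : left_inverse dsum_zero dsum_opp dsum_add.
Proof. by move=> x; apply: direct_sum_ext => i /=; rewrite addNr. Qed.

HB.instance Definition _ :=
  GRing.isZmodule.Build direct_sum dsum_addA dsum_addC dsum_add0 dsum_addN.

Definition dsum_degree (x : direct_sum) (d : nat) : Prop :=
  x d != 0 /\ forall i : nat, (d < i)%N -> x i = 0.

End DirectSum.

Notation dsum_cyc q := (direct_sum (fun i : nat => Zcyc (q i))).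

(* An element of Z(q^oo) is the argument in [0, 1[ of a q^n-th root of unity;
   addition is addition modulo 1. *)
Definition fracq (x : rat) : rat := x - (Num.floor x)%:~R.

Definition prufer_pred (q : nat) : pred rat :=
  fun x => (0 <= x < 1) && `[< exists n : nat, x * (q ^ n)%:R \is a Num.int >].

Record prufer (q : nat) : Type :=
  Prufer { prval : rat ; _ : prufer_pred q prval }.

Section PruferGroup.
Variable q : nat.

HB.instance Definition _ := [isSub for @prval q].
HB.instance Definition _ := [Choice of prufer q by <:].

Lemma fracq_id x : 0 <= x < 1 -> fracq x = x.
Proof.
by move=> x01; rewrite /fracq (floor_def (m := 0)) ?subr0.
Qed.

Lemma fracqDz x (n : int) : fracq (x + n%:~R) = fracq x.
Proof.
rewrite /fracq floorDrz ?intr_int // intrKfloor intrD.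
by rewrite opprD addrACA subrr addr0.
Qed.

Lemma fracqDl x y : fracq (fracq x + y) = fracq (x + y).
Proof. by rewrite {2}/fracq addrAC -mulrNz fracqDz. Qed.

Lemma fracqDr x y : fracq (x + fracq y) = fracq (x + y).
Proof. by rewrite addrC fracqDl addrC. Qed.

Lemma prufer_fracq x :
  (exists n : nat, x * (q ^ n)%:R \is a Num.int) -> prufer_pred q (fracq x).
Proof.
move=> [n xn]; apply/andP; split.
  by rewrite /fracq subr_ge0 Num.Theory.floor_le ltrBlDl -(intrD _ _ 1) floorD1_gt.
by apply/asboolP; exists n; rewrite /fracq mulrBl rpredB // rpredM ?intr_int ?natr_int.
Qed.

Lemma prvalP (x : prufer q) : prufer_pred q (prval x).
Proof. by case: x. Qed.

Lemma prval01 (x : prufer q) : 0 <= prval x < 1.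
Proof. by have /andP[] := prvalP x. Qed.

Lemma prvalX (x : prufer q) : exists n : nat, prval x * (q ^ n)%:R \is a Num.int.
Proof. by have /andP[_ /asboolP] := prvalP x. Qed.

Lemma prufer_addP (x y : prufer q) : prufer_pred q (fracq (prval x + prval y)).
Proof.
apply: prufer_fracq; case: (prvalX x) (prvalX y) => n xn [p yp].
exists (n + p)%N; rewrite expnD natrM mulrDl mulrA rpredD //.
  by rewrite rpredM ?natr_int.
by rewrite mulrCA rpredM ?natr_int.
Qed.

Lemma prufer_oppP (x : prufer q) : prufer_pred q (fracq (- prval x)).
Proof.
by apply: prufer_fracq; have [n xn] := prvalX x; exists n; rewrite mulNr rpredN.
Qed.

Lemma prufer_zeroP : prufer_pred q 0.
Proof.
apply/andP; split; first by rewrite lexx ltr01.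
by apply/asboolP; exists 0%N; rewrite mul0r rpred0.
Qed.

Definition prufer_zero : prufer q := Prufer prufer_zeroP.
Definition prufer_opp (x : prufer q) : prufer q := Prufer (prufer_oppP x).
Definition prufer_add (x y : prufer q) : prufer q := Prufer (prufer_addP x y).

Lemma prufer_addA : associative prufer_add.
Proof. by move=> x y z; apply: val_inj; rewrite /= fracqDl fracqDr addrA. Qed.

Lemma prufer_addC : commutative prufer_add.
Proof. by move=> x y; apply: val_inj; rewrite /= addrC. Qed.

Lemma prufer_add0 : left_id prufer_zero prufer_add.
Proof. by move=> x; apply: val_inj; rewrite /= add0r fracq_id ?prval01. Qed.

Lemma prufer_addN : left_inverse prufer_zero prufer_opp prufer_add.
Proof.
by move=> x; apply: val_inj; rewrite /= fracqDl addNr fracq_id.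
Qed.

HB.instance Definition _ := GRing.isZmodule.Build (prufer q)
  prufer_addA prufer_addC prufer_add0 prufer_addN.

End PruferGroup.

Definition prufer_frac (q : nat) (x : prufer q) (M j : nat) : Prop :=
  [/\ (1 <= j <= q ^ M - 1)%N, ~~ (q %| j)%N
    & prval x = j%:R / (q ^ M)%:R].

Definition prufer_degree (q : nat) (x : prufer q) (d : nat) : Prop :=
  exists j : nat, prufer_frac x d.+1 j.

Definition enum_dsum_const (q : nat) (chi : nat -> dsum_cyc (fun _ : nat => q)) : Prop :=
  chi 0%N = 0 /\
  forall (psi : dsum_cyc (fun _ : nat => q)) (d : nat), dsum_degree psi d ->
    chi (\sum_(i < d.+1) rep (psi i) * q ^ i)%N = psi.

Definition enum_prufer (q : nat) (chi : nat -> prufer q) : Prop :=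
  chi 0%N = 0 /\
  forall d : nat,
    set_bij [set n : nat | (q ^ d <= n < q ^ d.+1)%N]
            [set psi : prufer q | prufer_degree psi d] chi /\
    forall n n' j j' : nat, (q ^ d <= n)%N -> (n < n')%N -> (n' < q ^ d.+1)%N ->
      prufer_frac (chi n) d.+1 j -> prufer_frac (chi n') d.+1 j' -> (j < j')%N.

(* The condition on psi_d says that its representative in
   {-(q_d - 1)/2, ..., (q_d - 1)/2} is r or -r. The bijections on the blocks
   are arbitrary, so this predicate does not determine chi. *)
Definition enum_dsum (q : nat -> nat) (chi : nat -> dsum_cyc q) : Prop :=
  chi 0%N = 0 /\
  forall d r : nat, (1 <= r <= (q d).-1./2)%N ->
    set_bij
      [set n : nat | ((2 * r - 1) * \prod_(i < d) q i <= n
                       < (2 * r + 1) * \prod_(i < d) q i)%N]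
      [set psi : dsum_cyc q | dsum_degree psi d /\
         (psi d = (inZp r : 'I_(q d).-1.+1) \/
          psi d = - (inZp r : 'I_(q d).-1.+1))]
      chi.

(* The m-tuples counted by r_{N,t}^(m)(E), where g = chi_N. *)
Definition rep_tuples (G : zmodType) (chi : nat -> G) (E : set G) (m t : nat)
    (g : G) : set (m.-tuple nat) :=
  [set a : m.-tuple nat |
    [/\ (forall k : nat, k \in a -> (1 <= k)%N /\ E (chi k)),
        \sum_(k <- take t a) chi k - \sum_(k <- drop t a) chi k = g,
        sorted ltn (take t a), sorted ltn (drop t a) & uniq a]].

(* r_N^(m)(E), where g = chi_N; it is +oo when there are infinitely many
   representations. *)
Definition rep_number (R : realType) (G : zmodType) (chi : nat -> G) (E : set G)
    (m : nat) (g : G) : \bar R :=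
  (\sum_(t < m.+1) counting (rep_tuples chi E (m := m) t g))%E.

Definition card_upto (R : realType) (G : zmodType) (chi : nat -> G) (E : set G)
    (n : nat) : \bar R :=
  counting ([set chi k | k in [set k : nat | (1 <= k <= n)%N]] `&` E).

(* Main.v *)
Require Import Defs.
From HB Require Import structures.
From mathcomp Require Import all_boot all_order all_algebra.
From mathcomp Require Import all_classical all_reals all_analysis.
From mathcomp Require Import zify lra.

Set Implicit Arguments.
Unset Strict Implicit.
Unset Printing Implicit Defensive.

Import Order.TTheory GRing.Theory Num.Theory.

Local Open Scope classical_set_scope.
Local Open Scope ring_scope.

(** All four enumerations are injective on the positive integers and avoid 0
    there, and [thin_set] builds the set in every abelian group with such an
    enumeration.  Its lower bound holds for every n, so in the last group the
    good n are all the positive integers.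

    The set is built greedily, by adding one index after another.  Call a
    tuple of distinct indices split into a positive and a negative part a signed
    selection.  A selection of i+1 indices that uses a newly added index x
    contains a selection of i old indices whose sum is g - chi x or g + chi x.
    Hence, if sums of i terms have at most D representations, adding x raises
    the number of representations of any g as a sum of i+1 terms by at most
    2 D.  Grade the elements g by tiers: g is in tier j for i+1 terms when it
    has more than j * 2 D representations.  An element that enters tier j+1
    was already in tier j ([heavy_cons]).  If tier J stays empty, sums of i+1
    terms have at most J * 2 D representations, so by recursion on i all sums
    of i terms with i <= m have at most (2J)^i representations ([nrep_le]).

    It remains to keep tier J empty while taking indices from a small interval.
    For x varying in 1, ..., n and k indices chosen so far, the number of
    elements promoted from tier j by x is on average at most
    2 (2k)^i |tier j| / n ([sum_fresh]), since each g in tier j and each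
    old sum s leave at most one x with chi x = g - s and at most one with
    chi x = s - g.  By Markov's inequality and the union bound over the m J pairs
    (i, j), one x is within a constant factor of all these averages at once
    ([exists_light]).  Now let k be about 2^(Ld) and n a constant times
    2^((Lm+1)d), so that n exceeds k^m by a factor of order 2^d.  Adding k such
    indices promotes at most a constant times k^m |tier j| / n elements,
    that is about 2^(-d) |tier j|.  So tier j has at most about 2^(d(J-j))
    elements, with J = L m.  At the top, one step would promote less than one
    element, hence none, into tier J.  The list reached this way has 2^(Ld)
    indices below a constant times (2^(Ld))^(m+1/L), which is the
    exponent 1/m - eps once L is large ([exponent_approx]). *)

(** * Averaging and the union bound *)

Lemma leq_expn2r a b n : (a <= b -> a ^ n <= b ^ n)%N.
Proof. by case: n => // n ab; rewrite leq_exp2r. Qed.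

Section Pigeonhole.
Local Open Scope nat_scope.
Variable T : eqType.
Implicit Types (p l : seq T).

(** Markov's inequality in integers.  It is cross-multiplied so as to cover B = 0,
    where no x is counted. *)
Lemma markov_count p (f : T -> nat) (B W n : nat) :
  \sum_(x <- p) f x <= B ->
  W * count (fun x => W * B < f x * n) p <= n.
Proof.
move=> fB; set bad := fun x => _.
have [B0|Bgt0] := posnP B.
  suff -> : count bad p = 0 by rewrite muln0.
  apply/eqP; rewrite -leqn0 leqNgt -has_count; apply/hasPn => x xp.
  rewrite /bad B0 muln0 -leqNgt leqn0 muln_eq0; apply/orP; left.
  by move: fB; rewrite B0 leqn0 (big_rem x xp) /= addn_eq0 => /andP[].
rewrite -(leq_pmul2l Bgt0) mulnA [B * W]mulnC.
apply: (@leq_trans (\sum_(x <- p | bad x) f x * n)).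
  rewrite -sum1_count big_distrr /=; apply: leq_sum => x badx.
  by rewrite muln1 ltnW.
rewrite -big_distrl leq_mul2r; apply/orP; right.
by apply: leq_trans fB; rewrite [leqRHS](bigID bad) leq_addr.
Qed.

Lemma union_bound (I : finType) (bad : I -> pred T) p l :
  uniq p -> size l + \sum_i count (bad i) p < size p ->
  exists x, [/\ x \in p, x \notin l & forall i, ~~ bad i x].
Proof.
move=> up; rewrite ltnNge => few.
pose ok x := (x \notin l) && [forall i, ~~ bad i x].
have /hasP[x xp /andP[xl /forallP xI]] : has ok p; last by exists x.
apply: contraR few => /hasPn nok.
apply: (@leq_trans (\sum_(x <- p) ((x \in l) + \sum_i bad i x))); last first.
  rewrite big_split /= exchange_big /= -big_mkcond.
  under [X in _ + X]eq_bigr do rewrite -big_mkcond.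
  apply: leq_add.
    rewrite sum1_count -size_filter; apply: uniq_leq_size.
      exact: filter_uniq.
    by move=> x; rewrite mem_filter => /andP[].
  by apply: leq_sum => i _; rewrite sum1_count.
rewrite -sum1_size big_seq [leqRHS]big_seq; apply: leq_sum => x /nok.
rewrite /ok negb_and negbK => /orP[->//|/forallPn[i]].
by rewrite negbK (bigD1 i) //= => ->; rewrite addnCA.
Qed.

End Pigeonhole.

Section SignedSums.
Local Open Scope nat_scope.
Variables (G : zmodType) (chi : nat -> G) (J : nat).
Implicit Types (l p : seq nat) (g : G).

(** The recursion follows whether the head of l is left out, taken with a plus
    sign or taken with a minus sign, which is how the count changes when one
    index is added.  The order inside the two parts is that of l, so a pair of
    sorted lists is found only up to permutation. *)
Fixpoint selections l (m : nat) : seq (seq nat * seq nat) :=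
  if m is m'.+1 then
    if l is x :: l' then
      selections l' m ++ [seq (x :: s.1, s.2) | s <- selections l' m']
        ++ [seq (s.1, x :: s.2) | s <- selections l' m']
    else [::]
  else [:: ([::], [::])].

Definition signed_sum (s : seq nat * seq nat) : G :=
  (\sum_(k <- s.1) chi k - \sum_(k <- s.2) chi k)%R.

Definition signed_sums l m := [seq signed_sum s | s <- selections l m].
Definition nrep l m g := count_mem g (signed_sums l m).

Lemma mem_selections l (P Q : seq nat) :
  uniq (P ++ Q) -> {subset P ++ Q <= l} ->
  exists s, [/\ s \in selections l (size P + size Q), perm_eq s.1 P
             & perm_eq s.2 Q].
Proof.
elim: l P Q => [|x l IH] P Q uPQ subl.
  case: P Q {uPQ} subl => [|a P] [|b Q] subl.
  - by exists ([::], [::]); rewrite inE eqxx.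
  - by have := subl b; rewrite inE eqxx => /(_ isT).
  - by have := subl a; rewrite inE eqxx => /(_ isT).
  - by have := subl a; rewrite inE eqxx => /(_ isT).
have [xP|xP] := boolP (x \in P).
  have PQE : perm_eq (P ++ Q) (x :: rem x P ++ Q).
    by rewrite -cat_cons perm_cat2r perm_to_rem.
  have := uPQ; rewrite (perm_uniq PQE) => /andP[xnot uPQ'].
  have [|s [sl s1 s2]] := IH _ _ uPQ'.
    move=> y y'; have := subl y; rewrite (perm_mem PQE) inE y' orbT inE.
    by case/(_ isT)/predU1P => // yx; rewrite yx (negPf xnot) in y'.
  exists (x :: s.1, s.2); split=> //=; last first.
    by rewrite (perm_trans _ (_ : perm_eq (x :: rem x P) P)) ?perm_cons // perm_sym perm_to_rem.
  rewrite size_rem // in sl; case: P xP sl {PQE uPQ subl xnot uPQ' s1} => //= a P _ sl.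
  rewrite !mem_cat; apply/orP; right; apply/orP; left.
  by apply/mapP; exists s.
have [xQ|xQ] := boolP (x \in Q).
  have PQE : perm_eq (P ++ Q) (x :: P ++ rem x Q).
    by rewrite perm_sym -cat1s perm_catCA perm_cat2l perm_sym perm_to_rem.
  have := uPQ; rewrite (perm_uniq PQE) => /andP[xnot uPQ'].
  have [|s [sl s1 s2]] := IH _ _ uPQ'.
    move=> y y'; have := subl y; rewrite (perm_mem PQE) inE y' orbT inE.
    by case/(_ isT)/predU1P => // yx; rewrite yx (negPf xnot) in y'.
  exists (s.1, x :: s.2); split=> //=; last first.
    by rewrite (perm_trans _ (_ : perm_eq (x :: rem x Q) Q)) ?perm_cons // perm_sym perm_to_rem.
  rewrite size_rem // in sl; case: Q xQ sl {PQE uPQ subl xnot uPQ' s2} => //= a Q _ sl.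
  rewrite addnS /= !mem_cat; apply/orP; right; apply/orP; right.
  by apply/mapP; exists s.
have [|s [sl s1 s2]] := IH _ _ uPQ.
  move=> y yPQ; have := subl y yPQ; rewrite inE => /predU1P[yx|//].
  by move: yPQ; rewrite yx mem_cat (negPf xP) (negPf xQ).
exists s; split=> //; move: sl; case: (size P + size Q) => [|n] sl /=.
  by case: l {IH subl} sl.
by rewrite mem_cat sl.
Qed.

Lemma signed_sums_cons x l m :
  perm_eq (signed_sums (x :: l) m.+1)
    (signed_sums l m.+1 ++ [seq (g + chi x)%R | g <- signed_sums l m]
       ++ [seq (g - chi x)%R | g <- signed_sums l m]).
Proof.
rewrite /signed_sums /= !map_cat -!map_comp perm_cat2l.
suff [-> ->] : map (signed_sum \o (fun s => (x :: s.1, s.2))) (selections l m) =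
    map ((fun g => (g + chi x)%R) \o signed_sum) (selections l m) /\
  map (signed_sum \o (fun s => (s.1, x :: s.2))) (selections l m) =
    map ((fun g => (g - chi x)%R) \o signed_sum) (selections l m) by [].
split; apply: eq_map => s; rewrite /signed_sum /= big_cons.
  by rewrite [RHS]addrAC [(chi x + _)%R]addrC.
by rewrite opprD addrA [RHS]addrAC.
Qed.

Lemma nrep_cons x l m g :
  nrep (x :: l) m.+1 g =
  nrep l m.+1 g + (nrep l m (g - chi x)%R + nrep l m (g + chi x)%R).
Proof.
rewrite /nrep (permP (signed_sums_cons x l m)) !count_cat !count_map.
congr (_ + (_ + _)); apply: eq_count => h /=.
  by apply/eqP/eqP => [<-|->]; rewrite ?addrK ?subrK.
by apply/eqP/eqP => [<-|->]; rewrite ?addrK ?subrK.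
Qed.

Lemma nrep0 l g : nrep l 0 g = (g == 0%R).
Proof. by case: l => [|x l]; rewrite /nrep /signed_sums /signed_sum /= !big_nil subr0 addn0 eq_sym. Qed.

Lemma size_signed_sums l m : size (signed_sums l m) <= (2 * size l) ^ m.
Proof.
elim: l m => [|x l IH] [|m] //.
rewrite (perm_size (signed_sums_cons x l m)) !size_cat !size_map.
apply: (@leq_trans ((2 * size l) ^ m.+1 + 2 * (2 * size l) ^ m)).
  by have := IH m; have := IH m.+1; rewrite !size_map; lia.
rewrite expnS -mulnDl [leqRHS]expnS /= mulnS addnC leq_mul2l.
by rewrite leq_expn2r ?orbT ?leq_addl.
Qed.

Lemma mem_signed_sums l m g : (g \in signed_sums l m) = (0 < nrep l m g).
Proof. by rewrite /nrep -has_count has_pred1. Qed.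

(** Tier j for sums of m+1 terms.  The step 2 (2J)^m is the largest increase of
    the number of representations caused by one new index when sums of m terms
    have at most (2J)^m representations. *)
Definition heavy l m j : seq G :=
  [seq g <- undup (signed_sums l m.+1) | j * (2 * (2 * J) ^ m) < nrep l m.+1 g].

Lemma mem_heavy l m j g :
  (g \in heavy l m j) = (j * (2 * (2 * J) ^ m) < nrep l m.+1 g).
Proof.
rewrite mem_filter mem_undup mem_signed_sums andb_idr //; exact: leq_ltn_trans.
Qed.

Lemma size_heavy l m j : size (heavy l m j) <= (2 * size l) ^ m.+1.
Proof.
rewrite size_filter; apply: leq_trans (count_size _ _) _.
exact: leq_trans (size_undup _) (size_signed_sums _ _).
Qed.

(** Tier-j elements that gain a representation when x is added. *)
Definition fresh x l m j :=
  count [pred g | (g - chi x \in signed_sums l m)%R || (g + chi x \in signed_sums l m)%R]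
    (heavy l m j).

(** One new index cannot lift an element by two tiers, so the newcomers of tier
    j+1 come from tier j and must have gained a representation. *)
Lemma heavy_cons x l m j :
  (forall g, nrep l m g <= (2 * J) ^ m) ->
  size (heavy (x :: l) m j.+1) <= size (heavy l m j.+1) + fresh x l m j.
Proof.
move=> nrepl; rewrite /fresh -size_filter -size_cat.
apply: uniq_leq_size => [|g]; first by rewrite filter_uniq ?undup_uniq.
rewrite mem_heavy nrep_cons mem_cat mem_heavy => hg.
rewrite mem_filter mem_heavy /= !mem_signed_sums.
have [//|lt /=] := ltnP (j.+1 * _); apply/andP; split.
  by rewrite -addn_gt0 lt0n; apply: contraTneq hg => ->; rewrite addn0 -leqNgt.
by have := nrepl (g - chi x)%R; have := nrepl (g + chi x)%R; lia.
Qed.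

(** Double counting: for a fixed g, the map sending x to g - chi x is injective,
    so it meets the list of old sums at most as often as that list is long;
    the same holds for g + chi x. *)
Lemma sum_fresh p l m j : uniq p -> {in p &, injective chi} ->
  \sum_(x <- p) fresh x l m j <= 2 * size (signed_sums l m) * size (heavy l m j).
Proof.
move=> up injp.
have -> : \sum_(x <- p) fresh x l m j = \sum_(g <- heavy l m j)
   count [pred x | (g - chi x \in signed_sums l m)%R || (g + chi x \in signed_sums l m)%R] p.
  under eq_bigr do rewrite /fresh -sum1_count big_mkcond.
  rewrite exchange_big; apply: eq_bigr => g _.
  by rewrite -sum1_count [RHS]big_mkcond.
rewrite -[size (heavy _ _ _)]sum1_size big_distrr; apply: leq_sum => g _ /=.
rewrite muln1.
have countS (f : nat -> G) : {in p &, injective f} ->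
    count [pred x | f x \in signed_sums l m] p <= size (signed_sums l m).
  move=> injf; rewrite -size_filter -(size_map f).
  apply: uniq_leq_size => [|_ /mapP[x + ->]]; last by rewrite mem_filter => /andP[].
  rewrite map_inj_in_uniq ?filter_uniq // => x y.
  by rewrite !mem_filter => /andP[_ xp] /andP[_ yp]; exact: injf.
apply: leq_trans (_ : count [pred x | (g - chi x \in signed_sums l m)%R] p +
   count [pred x | (g + chi x \in signed_sums l m)%R] p <= _).
  by rewrite -count_predUI leq_addr.
rewrite mul2n -addnn leq_add // countS // => x y xp yp.
  by move/addrI/oppr_inj; exact: injp.
by move/addrI; exact: injp.
Qed.

(** A single index that does not promote much more than the average, for all
    lengths and tiers at once.  The factor 2 m J makes the bad indices of
    the m J pairs at most half of the pool, and fewer than the other half are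
    in l. *)
Lemma exists_light m k p l : 0 < m -> 0 < J -> 0 < k ->
  uniq p -> {in p &, injective chi} -> 2 * k < size p -> size l <= k ->
  exists x : nat, [/\ x \in p, x \notin l & forall i j, i < m -> j < J ->
    fresh x l i j * size p <=
      2 * (m * J) * (2 * (2 * k) ^ m.-1 * size (heavy l i j))].
Proof.
move=> m0 J0 k0 up injp kp lk.
pose bnd (i : 'I_m * 'I_J) := 2 * (2 * k) ^ m.-1 * size (heavy l i.1 i.2).
pose bad (i : 'I_m * 'I_J) x :=
  2 * (m * J) * bnd i < fresh x l i.1 i.2 * size p.
have badP i : 2 * (m * J) * count (bad i) p <= size p.
  apply: markov_count => //; apply: leq_trans (sum_fresh _ _ _ up injp) _.
  rewrite leq_mul2r leq_mul2l /=; apply/orP; right.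
  apply: leq_trans (size_signed_sums _ _) _.
  apply: (@leq_trans ((2 * k) ^ i.1)).
    by rewrite leq_expn2r // leq_mul2l lk orbT.
  by rewrite leq_pexp2l ?muln_gt0 // -ltnS prednK.
have [|x [xp xl xbad]] := @union_bound _ _ bad p l up.
  set S := \sum_i _.
  have : 2 * S <= size p.
    rewrite -(@leq_pmul2l (m * J)) ?muln_gt0 ?m0 //.
    rewrite mulnA [m * J * 2]mulnC big_distrr /=.
    apply: (@leq_trans (\sum_(i : 'I_m * 'I_J) size p)); first exact: leq_sum.
    by rewrite sum_nat_const card_prod !card_ord.
  have half a b n : 2 * k < n -> a <= k -> 2 * b <= n -> a + b < n by lia.
  exact: half.
exists x; split=> // i j im jJ.
by have := xbad (Ordinal im, Ordinal jJ); rewrite /bad -leqNgt.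
Qed.

End SignedSums.

(** * Building the index lists stage by stage *)

Section Stages.
Local Open Scope nat_scope.
Variables (G : zmodType) (chi : nat -> G) (m L : nat).
Hypotheses (m0 : 0 < m) (L0 : 0 < L).
Hypothesis chi_inj : {in [pred k | 0 < k] &, injective chi}.

(* With J = L m tiers, 2^J is the m-th power of 2^L, the growth of the list
   from one stage to the next. *)
Variable J : nat.
Hypothesis JE : J = L * m.
Local Notation heavy := (heavy chi J).
Local Notation nrep := (nrep chi).

Lemma J_gt0 : 0 < J. Proof. by rewrite JE muln_gt0 L0. Qed.

(** An empty tier J for sums of i+1 terms gives J * 2 (2J)^i = (2J)^(i+1)
    representations at most, which is the bound that the tiers for sums of
    i+2 terms are made for. *)
Lemma nrep_le l i g :
  (forall a, a < m -> heavy l a J = [::]) -> i <= m -> nrep l i g <= (2 * J) ^ i.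
Proof.
move=> hl; case: i => [|i] im; first by rewrite nrep0; case: eqP.
have := mem_heavy chi J l i J g; rewrite hl // in_nil.
by move/esym/negbT; rewrite -leqNgt mulnCA mulnA -expnS.
Qed.

(** The indices of stage d are taken below this number.  The exponent J+1 in
    place of J makes it exceed the m-th power of the length of the list by a
    factor 2^d, and the constant absorbs the 2 m J of [exists_light] and
    the factors 2^m coming from the signs. *)
Definition pool_size d := 4 * (m * J) * 4 ^ m * 2 ^ (J.+1 * d).

Definition stage d l := [/\ uniq l, {in l, forall k, 0 < k <= pool_size d},
  size l = 2 ^ (L * d),
  forall i, i < m -> heavy l i J = [::]
  & forall i j, i < m -> j < J -> size (heavy l i j) <= 2 ^ m * 2 ^ (d * (J - j))].

Lemma stage0 : stage 0 [:: 1].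
Proof.
have sub i j : i < m -> heavy [:: 1] i j.+1 = [::].
  move=> im; apply/size0nil/eqP; rewrite -leqn0.
  have nil j' : heavy [::] i j' = [::] by [].
  apply: leq_trans (heavy_cons 1 j _) _; last by rewrite /fresh !nil.
  by case: i im {nil} => [|i] im g; rewrite ?nrep0 //; case: eqP.
split=> // [k|||].
- rewrite inE => /eqP ->.
  by rewrite /pool_size muln0 !muln_gt0 m0 J_gt0 expn_gt0.
- by rewrite muln0.
- by move=> i im; have := sub i J.-1 im; rewrite prednK // J_gt0.
move=> i [|j] im jJ; last by rewrite sub.
rewrite mul0n muln1; apply: leq_trans (size_heavy _ _ _ _ _) _.
by rewrite leq_exp2l.
Qed.

(** The state of the tiers after k additions on the way from stage d to stage
    d+1: the tier sizes at the start of the stage, plus k times the largest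
    possible gain of one addition.  That gain is the bound of [exists_light],
    for a list of length at most 2^(L(d+1)) and for the tier sizes allowed at the end
    of the stage; everything is multiplied by the pool size. *)
Definition midstage d l k :=
  forall i j, i < m -> j.+1 < J ->
   size (heavy l i j.+1) * pool_size d.+1 <=
    2 ^ m * 2 ^ (d * (J - j.+1)) * pool_size d.+1
    + k * (2 * (m * J) * (2 * (2 * 2 ^ (L * d.+1)) ^ m.-1))
        * (2 ^ m * 2 ^ (d.+1 * (J - j))).

Lemma pool_sizeS d :
  pool_size d.+1 = 4 * (m * J) * 4 ^ m * ((2 ^ (L * d.+1)) ^ m * 2 ^ d.+1).
Proof.
by rewrite /pool_size -expnM -expnD; congr (_ * 2 ^ _); rewrite JE; lia.
Qed.

(** Going from stage d to stage d+1 at least doubles the allowed size of every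
    tier below J.  So the tiers inherited from stage d use at most half of it,
    and the gains of the whole stage use at most the other half. *)
Lemma midstage_le d l k : midstage d l k -> k <= 2 ^ (L * d.+1) ->
  size l <= 2 ^ (L * d.+1) ->
  forall i j, i < m -> j < J -> size (heavy l i j) <= 2 ^ m * 2 ^ (d.+1 * (J - j)).
Proof.
move=> mid kk lk i [|j] im jJ.
  rewrite subn0; apply: leq_trans (size_heavy _ _ _ _ _) _.
  apply: (@leq_trans ((2 * 2 ^ (L * d.+1)) ^ i.+1)).
    by rewrite leq_expn2r // leq_mul2l lk orbT.
  apply: (@leq_trans ((2 * 2 ^ (L * d.+1)) ^ m)).
    by rewrite leq_pexp2l // muln_gt0 expn_gt0.
  by rewrite expnMn -expnM leq_mul2l leq_exp2l // JE; lia.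
have n0 : 0 < pool_size d.+1 by rewrite !muln_gt0 m0 J_gt0 !expn_gt0.
rewrite -(leq_pmul2r n0); apply: leq_trans (mid _ _ im jJ) _.
set K := 2 ^ (L * d.+1) in kk lk *; set n := pool_size _ in n0 *.
set Z := 2 ^ (d.+1 * (J - j.+1)).
have -> : 2 ^ (d.+1 * (J - j)) = 2 ^ d.+1 * Z.
  by rewrite -expnD -mulnS subnSK // ltnW.
have hZ : 2 * 2 ^ (d * (J - j.+1)) <= Z by rewrite -expnS leq_exp2l //; lia.
have h : 2 * (k * (2 * (m * J) * (2 * (2 * K) ^ m.-1)) * 2 ^ d.+1) <= n.
  rewrite [n]pool_sizeS -/K.
  apply: (@leq_trans (2 * (K * (2 * (m * J) * (2 * (2 * K) ^ m.-1)) * 2 ^ d.+1))).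
    by rewrite leq_mul2l leq_mul2r leq_mul2r kk !orbT.
  have -> : 2 * (K * (2 * (m * J) * (2 * (2 * K) ^ m.-1)) * 2 ^ d.+1)
          = 4 * (m * J) * 2 ^ m * (K ^ m * 2 ^ d.+1).
    have -> : K ^ m = K * K ^ m.-1 by rewrite -expnS prednK.
    have -> : 2 ^ m = 2 * 2 ^ m.-1 by rewrite -expnS prednK.
    by rewrite expnMn; move: (2 ^ m.-1) (K ^ m.-1) (2 ^ d.+1) => a b c; lia.
  by rewrite leq_mul2r leq_mul2l leq_expn2r ?orbT.
rewrite -(@leq_pmul2l 2) // mulnDr.
have -> : 2 * (2 ^ m * Z * n) = 2 ^ m * Z * n + 2 ^ m * Z * n by lia.
apply: leq_add.
  by rewrite mulnA leq_mul2r mulnCA leq_mul2l hZ !orbT.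
apply: leq_trans (_ : 2 ^ m * Z * (2 * (k * (2 * (m * J) * (2 * (2 * K) ^ m.-1)) * 2 ^ d.+1)) <= _).
  by lia.
by rewrite leq_mul2l h orbT.
Qed.

(** Tier J stays empty because the bound of [exists_light] for tier J-1, which
    has at most 2^m 2^(d+1) elements, is smaller than the pool: the promoted
    elements number less than one. *)
Lemma stage_extend d l : stage d l ->
  forall k, size l + k <= 2 ^ (L * d.+1) ->
  exists e, [/\ size e = k, uniq (e ++ l),
     {in e, forall k, 0 < k <= pool_size d.+1},
     forall i, i < m -> heavy (e ++ l) i J = [::] & midstage d (e ++ l) k].
Proof.
move=> [ul pl sl lJ lj]; elim=> [|k IH] sk.
  exists [::]; split=> // i j im jJ.
  by rewrite !mul0n addn0 leq_mul2r lj ?orbT.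
have [|e [ek ue pe eJ mid]] := IH; first by lia.
set l' := e ++ l in ue eJ mid.
have sl' : size l' <= 2 ^ (L * d.+1) by rewrite size_cat; lia.
have hj := midstage_le mid (_ : k <= _) sl'.
set n := pool_size d.+1; set K := 2 ^ (L * d.+1) in sk sl' hj.
have kK : k < K by lia.
have K0 : 0 < K by rewrite expn_gt0.
have nK : n = 4 * (m * J) * 4 ^ m * (K ^ m * 2 ^ d.+1) by exact: pool_sizeS.
have Kn : K ^ m.-1 * K = K ^ m by rewrite -expnSr prednK.
have [||||x [xp xl' xle]] := @exists_light _ chi J m K (iota 1 n) l' m0 J_gt0 K0.
- exact: iota_uniq.
- move=> x y; rewrite !mem_iota => /andP[x0 _] /andP[y0 _].
  by apply: chi_inj; rewrite inE.
- rewrite size_iota nK; apply: (@leq_trans (4 * (K * 2))); first by lia.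
  rewrite leq_mul //.
    by rewrite -mulnA leq_pmulr // !muln_gt0 m0 J_gt0 expn_gt0.
  apply: leq_mul; last by rewrite expnS leq_pmulr ?expn_gt0.
  by rewrite -[leqLHS]expn1 leq_pexp2l.
- by [].
exists (x :: e); split=> //=.
- by rewrite ek.
- by rewrite xl'.
- move=> y; rewrite inE => /predU1P[->|/pe//].
  by move: xp; rewrite mem_iota add1n ltnS.
- move=> i im; apply/size0nil/eqP; rewrite -leqn0.
  have := @heavy_cons _ chi J x l' i J.-1.
  rewrite prednK ?J_gt0 // => hc; apply: leq_trans (hc _) _.
    by move=> g; apply: nrep_le => //; exact: ltnW.
  rewrite eJ //= add0n leqNgt; apply/negP => fpos.
  have := xle i J.-1 im; rewrite prednK ?J_gt0 // leqnn => /(_ isT).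
  rewrite size_iota leqNgt => /negP; apply.
  apply: leq_trans (leq_pmull n fpos).
  have := hj (ltnW kK) i J.-1 im; rewrite prednK ?J_gt0 // leqnn => /(_ isT).
  have -> : J - J.-1 = 1 by have := J_gt0; lia.
  rewrite muln1 => hJ.
  apply: leq_ltn_trans (_ : 2 * (m * J) * (2 * (2 * K) ^ m.-1 * (2 ^ m * 2 ^ d.+1)) < _).
    by rewrite !leq_mul2l hJ !orbT.
  rewrite nK -Kn.
  have -> : 2 * (m * J) * (2 * (2 * K) ^ m.-1 * (2 ^ m * 2 ^ d.+1)) =
     2 * (m * J) * 4 ^ m * (K ^ m.-1 * 2 ^ d.+1).
    have -> : 4 ^ m = 2 ^ m * (2 * 2 ^ m.-1) by rewrite -expnS prednK // -expnMn.
    by rewrite expnMn; lia.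
  have : 0 < m * J * 4 ^ m * (K ^ m.-1 * 2 ^ d.+1).
    by rewrite !muln_gt0 m0 J_gt0 !expn_gt0.
  nia.
move=> i j im jJ.
apply: leq_trans (_ : (size (heavy l' i j.+1) + fresh chi J x l' i j) * n <= _).
  rewrite leq_mul2r; apply/orP; right; apply: heavy_cons.
  by move=> g; apply: nrep_le => //; exact: ltnW.
have := xle i j im (ltnW jJ); rewrite size_iota mulnDl => xij.
apply: leq_trans (leq_add (mid i j im jJ) xij) _.
rewrite -addnA leq_add2l -/K [k.+1 * _]mulSn mulnDl addnC leq_add2r mulnA.
by rewrite leq_mul2l hj ?orbT // ltnW.
Qed.

Lemma stage_next d l : stage d l -> exists e, stage d.+1 (e ++ l).
Proof.
move=> sl; have [ul pl szl _ _] := sl.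
have le : size l <= 2 ^ (L * d.+1) by rewrite szl leq_exp2l // leq_mul2l leqnSn orbT.
have [|e [ek ue pe eJ mid]] := stage_extend sl (k := 2 ^ (L * d.+1) - size l).
  by rewrite subnKC.
have sz : size (e ++ l) = 2 ^ (L * d.+1) by rewrite size_cat ek subnK.
exists e; split=> //.
  move=> k; rewrite mem_cat => /orP[/pe//|/pl/andP[-> kd] /=].
  by apply: leq_trans kd _; rewrite leq_mul2l leq_exp2l // leq_mul2l leqnSn !orbT.
by apply: midstage_le mid _ _; rewrite ?sz // leq_subr.
Qed.

End Stages.

(** * From index lists to the counting measure *)

Lemma le_counting (R : realType) (T : choiceType) (A : set T) (s : seq T) :
  uniq s -> {in s, forall x, A x} -> ((size s)%:R%:E <= counting A :> \bar R)%E.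
Proof.
move=> us sA; rewrite /counting; case: asboolP => [fA|_]; last exact: leey.
rewrite lee_fin ler_nat; apply: uniq_leq_size => // x xs.
by rewrite in_fset_set // inE; exact: sA.
Qed.

Lemma counting_le (R : realType) (T : choiceType) (A : set T) (D : nat) :
  (forall s : seq T, uniq s -> {in s, forall x, A x} -> (size s <= D)%N) ->
  (counting A <= D%:R%:E :> \bar R)%E.
Proof.
move=> AD; rewrite /counting; case: asboolP => [fA|iA].
  rewrite lee_fin ler_nat; apply: AD => [|x]; first exact: finmap.fset_uniq.
  by rewrite in_fset_set // inE.
have [C CA] := infinite_set_fset D.+1 iA.
rewrite ltnNge AD ?finmap.fset_uniq // => x xC; exact: CA.
Qed.

Section Representations.
Variables (G : zmodType) (chi : nat -> G).

(** A tuple is determined by its two parts, and each part, being increasing, is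
    the sorted form of a part of a selection from l. *)
Lemma size_rep_tuples (E : set G) (m t : nat) (g : G) (l : seq nat)
    (s : seq (m.-tuple nat)) : uniq s ->
  {in s, forall a, rep_tuples chi E t g a /\ {subset a <= l}} ->
  (size s <= nrep chi l m g)%N.
Proof.
move=> us sl.
pose split_at (a : m.-tuple nat) := (take t a, drop t a).
have inj : injective split_at.
  move=> a b [tab dab]; apply: val_inj => /=.
  by rewrite -[LHS](cat_take_drop t) tab dab cat_take_drop.
rewrite /nrep count_map -size_filter -(size_map split_at).
rewrite -[leqRHS](size_map (fun p : seq nat * seq nat => (sort leq p.1, sort leq p.2))).
apply: uniq_leq_size; first by rewrite map_inj_uniq.
move=> _ /mapP[a /sl[[_ val sP sQ ua] al] ->].
have [||p [pl pP pQ]] := @mem_selections l (take t a) (drop t a).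
- by rewrite cat_take_drop.
- by rewrite cat_take_drop.
have szE : (size (take t a) + size (drop t a) = m)%N.
  by rewrite -size_cat cat_take_drop size_tuple.
rewrite szE in pl.
have sort_perm (x y : seq nat) : perm_eq x y -> sorted ltn y -> sort leq x = y.
  move=> xy; rewrite ltn_sorted_uniq_leq => /andP[_ sy].
  rewrite -[RHS](sorted_sort leq_trans sy).
  by apply/perm_sortP => //; [exact: leq_total | exact: leq_trans | exact: anti_leq].
apply/mapP; exists p; last by rewrite (sort_perm _ _ pP) // (sort_perm _ _ pQ).
rewrite mem_filter pl andbT /=; apply/eqP; rewrite -val /signed_sum.
by rewrite (perm_big _ pP) (perm_big _ pQ).
Qed.

End Representations.

(** The right-hand side is 1 / (m + 1/L), which is at least 1/m - 1/L. *)
Lemma exponent_approx (R : realType) (m : nat) (eps : R) : (0 < m)%N -> 0 < eps ->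
  exists2 L : nat, (0 < L)%N & m%:R^-1 - eps <= L%:R / (L * m).+1%:R.
Proof.
move=> m0 e0; have e1 : 0 <= eps^-1 by rewrite invr_ge0 ltW.
exists (Num.bound eps^-1).+1 => //; set L := _.+1.
have Le : 1 <= L%:R * eps.
  rewrite -ler_pdivrMr // mul1r ltW //; apply: lt_trans (archi_boundP e1) _.
  by rewrite ltr_nat.
have mR : 1 <= m%:R :> R by rewrite ler1n.
have m1 : m%:R^-1 <= 1 :> R by rewrite invf_le1 // (lt_le_trans ltr01).
rewrite ler_pdivlMr ?ltr0n // -natr1 natrM mulrBl !mulrDr mulr1 mulr1.
have -> : m%:R^-1 * (L%:R * m%:R) = L%:R :> R.
  by rewrite mulrCA mulVf ?mulr1 // gt_eqF // (lt_le_trans ltr01).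
have : 1 <= eps * (L%:R * m%:R).
  rewrite mulrA -[leLHS]mulr1; apply: ler_pM => //; by rewrite mulrC.
lra.
Qed.

Section ThinSet.
Variables (R : realType) (G : zmodType) (chi : nat -> G).

Lemma thin_set (m : nat) (eps : R) :
  {in [pred k | 0 < k]%N &, injective chi} -> (0 < m)%N -> 0 < eps ->
  exists (K : R) (E : set G),
    [/\ E `<=` [set chi k | k in [set k | 0 < k]%N],
        (forall g, (rep_number R chi E m g < K%:E)%E)
      & exists2 c : R, 0 < c & forall n : nat, (1 <= n)%N ->
          ((c * n%:R `^ (m%:R^-1 - eps))%:E <= card_upto R chi E n)%E].
Proof.
move=> chi_inj m0 eps0; have [L L0 Leps] := exponent_approx m0 eps0.
pose J := (L * m)%N; have JE : J = (L * m)%N by [].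
have [f fP] : exists f : nat -> seq nat -> seq nat, forall d l,
    stage chi m L J d l -> stage chi m L J d.+1 (f d l ++ l).
  have ex (x : nat * seq nat) : exists e, stage chi m L J x.1 x.2 ->
      stage chi m L J x.1.+1 (e ++ x.2).
    have [st|nst] := pselect (stage chi m L J x.1 x.2); last by exists [::].
    by have [e] := stage_next m0 L0 chi_inj JE st; exists e.
  have [f fP] := choice ex; exists (fun d l => f (d, l)) => d l.
  exact: (fP (d, l)).
pose idx := fix idx d : seq nat := if d is d'.+1 then f d' (idx d') ++ idx d' else [:: 1%N].
have idxP d : stage chi m L J d (idx d).
  by elim: d => [|d IH]; [exact: stage0 | exact: fP].
have idx_mono d d' : (d <= d')%N -> {subset idx d <= idx d'}.
  move=> /subnK <-; elim: (d' - d)%N => // n IH x /IH x_in.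
  by rewrite addSn /= mem_cat x_in orbT.
have idx_pos d k : k \in idx d -> (0 < k)%N by case: (idxP d) => _ h _ _ _ /h/andP[].
(* Two lists of the sequence are nested, so finitely many tuples from E live in
   a single one of them, and the bound for finite lists passes to E. *)
pose E : set G := [set chi k | k in [set k | exists d, k \in idx d]].
have memE k : (0 < k)%N -> E (chi k) -> exists d, k \in idx d.
  move=> k0 [k' [d k'idx] /chi_inj kk']; exists d.
  by rewrite -kk' ?inE // (idx_pos _ _ k'idx).
have cover (ks : seq nat) : {in ks, forall k, exists d, k \in idx d} ->
    exists d, {subset ks <= idx d}.
  elim: ks => [|k ks IH] h; first by exists 0%N.
  have [|d dks] := IH; first by move=> k' k'ks; apply: h; rewrite inE k'ks orbT.
  have [d' d'k] := h k (mem_head _ _).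
  exists (maxn d d') => k'; rewrite inE => /predU1P[->|/dks].
    by apply: idx_mono d'k; rewrite leq_maxr.
  by apply: idx_mono; rewrite leq_maxl.
exists (m.+1%:R * ((2 * J) ^ m)%:R + 1), E; split.
- by move=> _ [k [d k_in] <-]; exists k => //; exact: idx_pos k_in.
- move=> g; apply: (@le_lt_trans _ _ (\sum_(t < m.+1) ((2 * J) ^ m)%:R%:E)%E).
    apply: lee_sum => t _; apply: counting_le => s us sE.
    have [d d_sub] : exists d, {subset flatten (map val s) <= idx d}.
      apply: cover => k /flattenP[_ /mapP[a as_ ->] ka].
      by have [/(_ _ ka)[k0 Ek] _ _ _ _] := sE a as_; exact: memE.
    apply: leq_trans (size_rep_tuples (l := idx d) us _) _ => [a as_|].
      split; first exact: sE.
      by move=> k ka; apply: d_sub; apply/flattenP; exists (val a) => //; exact: map_f.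
    have [_ _ _ hJ _] := idxP d; exact: (nrep_le g hJ (leqnn m)).
  rewrite sumEFin lte_fin sumr_const card_ord -[ltLHS]mulr_natl.
  by rewrite ltrDl.
pose a : R := (pool_size m J 0)%:R.
have a1 : 1 <= a by rewrite ler1n /pool_size !muln_gt0 m0 L0 !expn_gt0.
have a0 : 0 < a := lt_le_trans ltr01 a1.
exists (a * 2 ^+ L)^-1; first by rewrite invr_gt0 mulr_gt0 ?exprn_gt0.
move=> n n0.
(* Take the least stage whose successor has a pool reaching n.  Its own list lies
   below n: by minimality, or because the list of stage 0 is [:: 1]. *)
have [d dn nd] : exists2 d, {in idx d, forall k, k <= n}%N & (n <= pool_size m J d.+1)%N.
  have ex : exists d, (n <= pool_size m J d.+1)%N.
    exists n; rewrite /pool_size; apply: leq_trans (ltnW (ltn_expl n (ltnSn 1))) _.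
    apply: leq_trans (leq_pmull _ _); first by rewrite leq_exp2l //; nia.
    by rewrite !muln_gt0 m0 L0 !expn_gt0.
  case: (ex_minnP ex) => -[|d] nd dmin; [exists 0%N | exists d.+1] => //.
    by move=> k; rewrite inE => /eqP ->.
  move=> k k_in; have [_ /(_ _ k_in)/andP[_ kd] _ _ _] := idxP d.+1.
  apply: leq_trans kd _; rewrite leqNgt; apply/negP => /ltnW /dmin.
  by rewrite ltnn.
apply: (@le_trans _ _ (2 ^+ (L * d))%:E); last first.
  have [u_idx _ sz_idx _ _] := idxP d.
  rewrite -natrX -sz_idx -(size_map chi); apply: le_counting.
    by rewrite map_inj_in_uniq // => x y x_in y_in; apply: chi_inj; rewrite inE (idx_pos d).
  move=> _ /mapP[k k_in ->]; split; exists k => //=; last by exists d.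
  by rewrite (idx_pos _ _ k_in) dn.
rewrite lee_fin mulrC ler_pdivrMr ?mulr_gt0 ?exprn_gt0 //.
apply: le_trans (ler_powR _ Leps) _; first by rewrite ler1n.
set alpha := _ / _.
have alpha0 : 0 <= alpha by rewrite divr_ge0.
have alpha1 : alpha <= 1.
  by rewrite ler_pdivrMr ?ltr0n // mul1r ler_nat; nia.
apply: (@le_trans _ _ ((pool_size m J d.+1)%:R `^ alpha)).
  by rewrite ge0_ler_powR // ?nnegrE // ler_nat.
have -> : (pool_size m J d.+1)%:R = a * 2 `^ (J.+1 * d.+1)%:R :> R.
  by rewrite powR_mulrn // /a /pool_size muln0 muln1 natrM natrX.
rewrite (powRM _ (ltW a0) (powR_ge0 _ _)) -powRrM.
have -> : (J.+1 * d.+1)%:R * alpha = (L * d + L)%:R.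
  rewrite -mulnSr /alpha natrM [RHS]natrM.
  by rewrite [L%:R / _]mulrC mulrACA divff ?mul1r ?mulr1 ?pnatr_eq0 // mulrC.
rewrite powR_mulrn // exprD mulrCA ler_pM2l ?exprn_gt0 // ler_pM2r ?exprn_gt0 //.
by apply: le_trans (ler_powR a1 alpha1) _; rewrite powRr1 // ltW.
Qed.

End ThinSet.

(** * The enumerations are injective and avoid 0 *)

Lemma dsum_degree_inj (V : nat -> zmodType) (x : direct_sum V) d d' :
  dsum_degree x d -> dsum_degree x d' -> d = d'.
Proof.
move=> [xd dx] [xd' dx']; case: (ltngtP d d') => // [/dx|/dx'] e.
  by rewrite e eqxx in xd'.
by rewrite e eqxx in xd.
Qed.

Lemma dsum_degree_neq0 (V : nat -> zmodType) (x : direct_sum V) d :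
  dsum_degree x d -> x != 0.
Proof. by move=> [xd _]; apply: contraNneq xd => ->. Qed.

Lemma sum_digits (q n d : nat) :
  (\sum_(i < d) (n %/ q ^ i %% q) * q ^ i = n %% q ^ d)%N.
Proof.
elim: d => [|d IH]; first by rewrite big_ord0 modn1.
rewrite big_ord_recr /= IH modn_divl -expnS.
by rewrite -(@modn_dvdm (q ^ d.+1) n (q ^ d)) ?dvdn_exp2l // addnC -divn_eq.
Qed.

Lemma digits_exist (q n : nat) : (1 < q)%N -> (0 < n)%N ->
  exists (psi : dsum_cyc (fun _ : nat => q)) (d : nat),
    dsum_degree psi d /\ n = (\sum_(i < d.+1) rep (psi i) * q ^ i)%N.
Proof.
move=> q1 n0; have qE : q.-1.+1 = q by rewrite prednK // ltnW.
pose dig i : Zcyc q := inZp (n %/ q ^ i).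
have dig0 i : (n < q ^ i)%N -> dig i = 0.
  by move=> ni; apply: val_inj; rewrite /= divn_small ?mod0n.
have fin : exists k, forall i, (k <= i)%N -> dig i = 0.
  exists n => i ni; apply: dig0; apply: leq_trans (ltn_expl n q1) _.
  by rewrite leq_exp2l.
exists (DirectSum fin), (trunc_log q n).
have /andP[le lt] := trunc_log_bounds q1 n0.
split; first split=> /= [|i di].
- apply/eqP => /(congr1 val) /=; rewrite qE modn_small.
    by move/eqP; rewrite eqn0Ngt divn_gt0 ?le // expn_gt0 (ltnW q1).
  by rewrite ltn_divLR ?expn_gt0 ?(ltnW q1) // -expnS.
- by apply: dig0; apply: leq_trans lt _; rewrite leq_exp2l.
rewrite /rep /= -[LHS](modn_small lt) -sum_digits.
by apply: eq_bigr => i _; rewrite qE.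
Qed.

Lemma enum_dsum_const_inj q (chi : nat -> dsum_cyc (fun _ : nat => q)) :
  (1 < q)%N -> enum_dsum_const chi ->
  {in [pred k | 0 < k]%N &, injective chi} /\
  forall n, (0 < n)%N -> chi n != 0.
Proof.
move=> q1 [_ chiE]; split=> [n n'|n]; last first.
  by move=> /(digits_exist q1)[psi [d [psid ->]]]; rewrite chiE // (dsum_degree_neq0 psid).
rewrite !inE => /(digits_exist q1)[psi [d [psid ->]]].
move=> /(digits_exist q1)[psi' [d' [psid' ->]]].
rewrite !chiE // => e; rewrite -{psi'}e in psid' *.
by rewrite (dsum_degree_inj psid psid').
Qed.

Lemma prufer_frac_inj q (x : prufer q) M M' j j' : (0 < q)%N ->
  prufer_frac x M j -> prufer_frac x M' j' -> M = M'.
Proof.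
move=> q0.
wlog leM : M M' j j' / (M <= M')%N => [hw|].
  case: (leqP M M') => [/hw|/ltnW/hw h h1 h2]; first exact.
  by apply/esym; apply: h h2 h1.
move=> [_ _ xE] [_ nj' xE'].
have qX k : (q ^ k)%:R != 0 :> rat by rewrite pnatr_eq0 -lt0n expn_gt0 q0.
have jE : (j * q ^ (M' - M) = j')%N.
  have /eqP : j%:R / (q ^ M)%:R = j'%:R / (q ^ M')%:R :> rat by rewrite -xE.
  rewrite eqr_div // -!natrM eqr_nat -[in (q ^ M')%N](subnK leM) expnD mulnA.
  by rewrite eqn_pmul2r ?expn_gt0 ?q0 // => /eqP.
apply/eqP; rewrite eqn_leq leM /= -subn_eq0; apply: contraR nj'.
by rewrite -lt0n -jE; case: (M' - M)%N => // k _; rewrite expnS dvdn_mull // dvdn_mulr.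
Qed.

Lemma enum_prufer_inj q (chi : nat -> prufer q) : prime q -> enum_prufer chi ->
  {in [pred k | 0 < k]%N &, injective chi} /\
  forall n, (0 < n)%N -> chi n != 0.
Proof.
move=> /prime_gt1 q1 [_ bij].
have block n : (0 < n)%N -> exists2 d, (q ^ d <= n < q ^ d.+1)%N &
    prufer_degree (chi n) d.
  move=> /(trunc_log_bounds q1) nb; exists (trunc_log q n) => //.
  by have [[fun_chi _ _] _] := bij (trunc_log q n); exact: fun_chi.
split=> [n n'|n /block[d _ [j [/andP[j0 _] _ chiE]]]]; last first.
  apply/eqP => chi0; have : prval (chi n) = 0 by rewrite chi0.
  rewrite chiE => /eqP; rewrite mulf_eq0 invr_eq0 !pnatr_eq0.
  by rewrite !eqn0Ngt j0 expn_gt0 (ltnW q1).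
rewrite !inE => /block[d nd [j jP]] /block[d' nd' [j' jP']] e.
rewrite -e in jP'; have [dd'] := prufer_frac_inj (ltnW q1) jP jP'.
rewrite -dd' in nd'; have [[_ inj_chi _] _] := bij d.
by apply: inj_chi; rewrite ?inE.
Qed.

(** The odd multiples of P from P to P * Q cut this interval into the blocks of
    the enumeration; the parity of Q makes the last one end exactly at P * Q. *)
Lemma odd_block (Q P n : nat) : odd Q -> (P <= n)%N -> (n < P * Q)%N ->
  exists2 r, (1 <= r <= Q.-1./2)%N &
    ((2 * r - 1) * P <= n < (2 * r + 1) * P)%N.
Proof.
move=> oQ Pn nPQ; have P0 : (0 < P)%N by case: P nPQ {Pn}.
have k0 : (0 < n %/ P)%N by rewrite divn_gt0.
have kQ : (n %/ P < Q)%N by rewrite ltn_divLR // mulnC.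
have := leq_divM n P; have := ltn_ceil n P0; set k := (n %/ P)%N in k0 kQ *.
exists (uphalf k); first by lia.
apply/andP; split.
  by apply: leq_trans (_ : k * P <= n)%N; rewrite // leq_mul2r; lia.
by apply: leq_trans (_ : n < k.+1 * P)%N _; rewrite // leq_mul2r; lia.
Qed.

(** For representatives in the lower half, r = - r' is excluded because
    0 < r + r' < k. *)
Lemma opp_rep_inj (k r r' : nat) : (0 < r <= k.-1./2)%N -> (0 < r' <= k.-1./2)%N ->
  forall x : Zcyc k,
  x = (inZp r : 'I_k.-1.+1) \/ x = - (inZp r : 'I_k.-1.+1) ->
  x = (inZp r' : 'I_k.-1.+1) \/ x = - (inZp r' : 'I_k.-1.+1) -> r = r'.
Proof.
move=> hr hr' x.
have eqr (a b : nat) : (a < k)%N -> (b < k)%N ->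
    inZp a = inZp b :> 'I_k.-1.+1 -> a = b.
  by move=> ak bk /(congr1 val) /=; rewrite !modn_small //; lia.
have opp (a b : nat) : (0 < a)%N -> (a + b < k)%N ->
    inZp a = - inZp b :> 'I_k.-1.+1 -> a = b.
  move=> a0 abk /eqP; rewrite -addr_eq0 => /eqP /(congr1 val) /=.
  by rewrite modnDm modn_small; lia.
case=> ->; case.
- by apply: eqr; lia.
- by apply: opp; lia.
- by move/esym => e; apply/esym; move: e; apply: opp; lia.
- by move/oppr_inj; apply: eqr; lia.
Qed.

Lemma enum_dsum_inj (q : nat -> nat) (chi : nat -> dsum_cyc q) :
  {homo q : i j / (i < j)%N} -> (forall i, odd (q i)) -> enum_dsum chi ->
  {in [pred k | 0 < k]%N &, injective chi} /\
  forall n, (0 < n)%N -> chi n != 0.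
Proof.
move=> qmono qodd [_ bij]; pose P d := (\prod_(i < d) q i)%N.
have q_ge d : (d < q d)%N.
  elim: d => [|d IH]; first by case: (q 0%N) (qodd 0%N).
  by apply: leq_ltn_trans IH _; exact: qmono.
have PS d : (P d.+1 = P d * q d)%N by rewrite /P big_ord_recr.
(* q 0 may be 1, so the products need not double at the first step; they
   still exceed every bound. *)
have P_ge d : (d <= P d)%N.
  elim: d => // d IH; rewrite PS; case: d IH => [|d] IH.
    by rewrite /P big_ord0 mul1n; exact: q_ge.
  by have := q_ge d.+1; nia.
have block n : (0 < n)%N -> exists d r, [/\ (1 <= r <= (q d).-1./2)%N,
    ((2 * r - 1) * P d <= n < (2 * r + 1) * P d)%N, dsum_degree (chi n) d &
    chi n d = (inZp r : 'I_(q d).-1.+1) \/ chi n d = - (inZp r : 'I_(q d).-1.+1)].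
  move=> n0; have ex : exists d, (n < P d.+1)%N by exists n; exact: P_ge.
  have [d Pn nP] : exists2 d, (P d <= n)%N & (n < P d.+1)%N.
    case: (ex_minnP ex) => -[|d] nP dmin; [exists 0%N | exists d.+1] => //.
      by rewrite /P big_ord0.
    by rewrite leqNgt; apply/negP => /dmin; rewrite ltnn.
  rewrite PS in nP; have [r hr nr] := odd_block (qodd d) Pn nP.
  exists d, r; have [fun_chi _ _] := bij d r hr.
  by have [] := fun_chi n nr; split.
split=> [n n'|n /block[d [r [_ _ chid _]]]]; last exact: dsum_degree_neq0 chid.
rewrite !inE => /block[d [r [hr nr nd ndr]]] /block[d' [r' [hr' nr' nd' ndr']]] e.
rewrite -e in nd' ndr'; have dd' := dsum_degree_inj nd nd'.
subst d'; have rr' := opp_rep_inj hr hr' ndr ndr'.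
subst r'; have [_ inj_chi _] := bij d r hr.
by apply: inj_chi; rewrite ?inE.
Qed.

(** * The four groups *)

Theorem corollary3p6 (R : realType) (m : nat) (eps : R)
    (hm : (2 <= m)%N) (heps : 0 < eps) :
  (exists (K : R) (E : set int),
    [/\ E `<=` [set x | 0 < x],
        (forall N : int, (rep_number R Posz E m N < K%:E)%E)
      & exists2 c : R, 0 < c & forall n : nat, (1 <= n)%N ->
          ((c * n%:R `^ (m%:R^-1 - eps))%:E <= card_upto R Posz E n)%E])
  /\
  (forall (q : nat) (chi : nat -> dsum_cyc (fun _ : nat => q)),
    (2 <= q)%N -> enum_dsum_const chi ->
    exists (K : R) (E : set (dsum_cyc (fun _ : nat => q))),
    [/\ E `<=` [set x | x != 0],
        (forall N : nat, (rep_number R chi E m (chi N) < K%:E)%E)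
      & exists2 c : R, 0 < c & forall n : nat, (1 <= n)%N ->
          ((c * n%:R `^ (m%:R^-1 - eps))%:E <= card_upto R chi E n)%E])
  /\
  (forall (q : nat) (chi : nat -> prufer q),
    prime q -> enum_prufer chi ->
    exists (K : R) (E : set (prufer q)),
    [/\ E `<=` [set x | x != 0],
        (forall N : nat, (rep_number R chi E m (chi N) < K%:E)%E)
      & exists2 c : R, 0 < c & forall n : nat, (1 <= n)%N ->
          ((c * n%:R `^ (m%:R^-1 - eps))%:E <= card_upto R chi E n)%E])
  /\
  (forall (q : nat -> nat) (chi : nat -> dsum_cyc q),
    {homo q : i j / (i < j)%N} -> (forall i : nat, odd (q i)) ->
    enum_dsum chi ->
    exists (K : R) (E : set (dsum_cyc q)),
    [/\ E `<=` [set x | x != 0],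
        (forall N : nat, (rep_number R chi E m (chi N) < K%:E)%E)
      & exists2 c : R, 0 < c &
          infinite_set [set n : nat | (1 <= n)%N /\
            ((c * n%:R `^ (m%:R^-1 - eps))%:E <= card_upto R chi E n)%E]]).
Proof.
have m0 : (0 < m)%N by exact: ltnW.
split; last split; last split.
- have [x y _ _ []//|K [E [subE bdE cardE]]] := @thin_set R int Posz m eps _ m0 heps.
  by exists K, E; split=> // _ /subE[k k0 <-].
- move=> q chi q2 /(enum_dsum_const_inj q2)[inj neq0].
  have [K [E [subE bdE cardE]]] := thin_set inj m0 heps.
  by exists K, E; split=> // _ /subE[k k0 <-]; exact: neq0.
- move=> q chi qp /(enum_prufer_inj qp)[inj neq0].
  have [K [E [subE bdE cardE]]] := thin_set inj m0 heps.
  by exists K, E; split=> // _ /subE[k k0 <-]; exact: neq0.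
- move=> q chi qmono qodd /(enum_dsum_inj qmono qodd)[inj neq0].
  have [K [E [subE bdE [c c0 cardE]]]] := thin_set inj m0 heps.
  exists K, E; split=> //; first by move=> _ /subE[k k0 <-]; exact: neq0.
  exists c => // fin; apply: infinite_nat.
  apply: (@sub_finite_set _ _ ([set 0%N] `|` [set n : nat | (1 <= n)%N /\
    ((c * n%:R `^ (m%:R^-1 - eps))%:E <= card_upto R chi E n)%E])).
    by move=> [|n] _; [left | right; split=> //; exact: cardE].
  by rewrite finite_setU; split=> //; exact: finite_set1.
Qed.
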